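(* Let $\|\cdot\|$ be a norm on $\mathbb{R}^2$ and let $A\subseteq\mathbb{R}^2$ be a nonempty set that is approximately convex in this norm. Then any point $b\in\operatorname{Co}(A)$ satisfies $\operatorname{dist}(b,A)\le 2$. Moreover, for every norm on $\mathbb{R}^2$ and every $\varepsilon>0$ there exist an approximately convex set $A_\varepsilon\subseteq\mathbb{R}^2$ and a point $b\in\operatorname{Co}(A_\varepsilon)$ with $\operatorname{dist}(b,A_\varepsilon)\ge 2-\varepsilon$, so that $2$ is the sharp constant for all two-dimensional norms.
   Context: $\operatorname{Co}$ denotes convex hull and $\operatorname{dist}(x,A)=\inf\{\|x-a\|:a\in A\}$. A subset $A$ of a normed space is approximately convex if $\operatorname{dist}\bigl(\frac12(a+b),A\bigr)\le1$ for all $a,b\in A$. *)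

(* Defs.v *)
From mathcomp Require Import all_boot all_order all_algebra.
From mathcomp Require Import all_classical all_reals all_analysis.

Set Implicit Arguments.
Unset Strict Implicit.
Unset Printing Implicit Defensive.

Import Order.TTheory GRing.Theory Num.Theory.

Local Open Scope classical_set_scope.
Local Open Scope ring_scope.

(* An arbitrary norm is a function satisfying the norm axioms, kept apart from
   the canonical (supremum) norm `|x| that the library puts on row vectors.
   Nonnegativity and N 0 = 0 follow from these axioms. *)
Record is_norm (R : realType) (V : lmodType R) (N : V -> R) : Prop := IsNorm {
  is_normD : forall x y, N (x + y) <= N x + N y ;
  is_normZ : forall (c : R) x, N (c *: x) = `|c| * N x ;
  is_norm0_eq0 : forall x, N x = 0 -> x = 0
}.

Section approximate_convexity.
Context (R : realType) (V : lmodType R).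
Implicit Types (N : V -> R) (A : set V).

(* The real-valued inf is 0 on the empty set, so this is the usual distance only
   for nonempty A. *)
Definition dist N (x : V) A : R := inf [set N (x - a) | a in A].

Definition convex_hull A : set V := smallest (@convex_set R V) A.

Definition approx_convex N A : Prop :=
  forall a b, A a -> A b -> dist N (2^-1 *: (a + b)) A <= 1.

End approximate_convexity.

(* Main.v *)
Require Import Defs.
From mathcomp Require Import all_boot all_order all_algebra.
From mathcomp Require Import all_classical all_reals all_analysis.
From mathcomp Require Import ring lra.

Set Implicit Arguments.
Unset Strict Implicit.
Unset Printing Implicit Defensive.

Import Order.TTheory GRing.Theory Num.Theory.
Import numFieldNormedType.Exports.

Local Open Scope classical_set_scope.
Local Open Scope ring_scope.

(** Upper bound. Pretend first that [A] is finite and the norm strictly convex,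
    and let [b] lie in a triangle [T] with vertices in [A]. Move [b] to a point
    of [T] where the distance [r] to [A] is maximal.
    If some vertex [a] has weight at least 1/2 in [b], then the reflected point
    [2b - a] is still in [T], hence within [r] of some [p] in [A], and the
    midpoint of [a] and [p] is within [r/2] of [b] and within 1 of [A]; so
    [r <= r/2 + 1].
    Otherwise [b] is interior to [T]. Let [S] be the set of vectors [a - b], for
    [a] a point of [A] nearest to [b]; it lies on the sphere of radius [r].
    If [N (p + q) <= r] for some [p, q] in [S], the midpoint argument gives
    [r <= r/2 + 1] again. This happens whenever 0 is in the convex hull of three
    points of [S] ([zero_comb_pair]): if [s0] and [s1] carry the two largest
    weights, the combination expresses [s0 + s1] by vectors of total length at
    most [r]. In the remaining case [S] lies in a cone spanned by two of its
    members [p] and [q], and translating [b] by a small multiple of [-(p + q)]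
    moves it strictly away from all its nearest points ([escape_direction]),
    against the maximality of [r].

    The reduction to finite sets uses a fine finite net of a bounded part of
    [A] ([finite_net]); strict convexity is obtained by adding a small multiple
    of the Euclidean norm ([add_euclid_strict]); and a representation of [b] as
    a convex combination of the fewest possible points of [A] has affinely
    independent points, hence at most three ([caratheodory],
    [affinely_free_le3]). The errors introduced vanish in the limit.

    Sharpness. On dyadic rationals let [h (k / 2^j) = 2 - 2 / 2^j] for the least
    possible [j]. If [j] is the larger of the exponents of [x] and [y], their
    midpoint is a multiple of [1 / 2^(j+1)], and
    [2 - 1 / 2^j <= (h x + h y) / 2 + 1]. So the epigraph of [h] is
    approximately convex, measured vertically. It contains [(0, 0)] and
    [(1, 0)], while [h] is close to 2 near [1/3], because dyadic rationals close
    to [1/3] have large denominators. Put in the plane along unit vectors [e]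
    and [f] with [N f <= N (f + s e)] for all [s], and stretched enough in the
    direction [e], this epigraph stays at distance at least [2 - eps] from the
    point of abscissa [1/3] and height 0 ([dyadic_comb_dist]). *)

(** * Norms and distances *)

Section norm_basics.
Context (R : realType) (V : lmodType R) (N : V -> R).
Hypothesis nN : is_norm N.

Lemma norm0 : N 0 = 0.
Proof. by rewrite -(scale0r 0) (is_normZ nN) normr0 mul0r. Qed.

Lemma normN x : N (- x) = N x.
Proof. by rewrite -scaleN1r (is_normZ nN) normrN1 mul1r. Qed.

Lemma normBC x y : N (x - y) = N (y - x).
Proof. by rewrite -normN opprB. Qed.

Lemma norm_ge0 x : 0 <= N x.
Proof.
have := is_normD nN x (- x); rewrite subrr norm0 normN; lra.
Qed.

Lemma norm_gt0 x : x != 0 -> 0 < N x.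
Proof.
move=> x0; rewrite lt_def norm_ge0 andbT; apply: contraNneq x0 => /(is_norm0_eq0 nN) ->.
by [].
Qed.

Lemma normZ_ge0 c x : 0 <= c -> N (c *: x) = c * N x.
Proof. by move=> c0; rewrite (is_normZ nN) ger0_norm. Qed.

Lemma normB_le x y : N (x - y) <= N x + N y.
Proof. by rewrite -(normN y); apply: is_normD nN _ _. Qed.

Lemma le_normB x y : N x - N y <= N (x - y).
Proof. by have := is_normD nN (x - y) y; rewrite subrK; lra. Qed.

Lemma norm_sum (I : finType) (F : I -> V) : N (\sum_i F i) <= \sum_i N (F i).
Proof.
elim/big_rec2: _ => [|i y1 y2 _ h]; first by rewrite norm0.
by apply: le_trans (is_normD nN _ _) _; rewrite lerD2l.
Qed.

Lemma norm_dist_le x y z : N (x - z) <= N (x - y) + N (y - z).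
Proof. by have := is_normD nN (x - y) (y - z); rewrite addrA subrK. Qed.

End norm_basics.

Section distances.
Context (R : realType) (V : lmodType R) (N : V -> R).
Hypothesis nN : is_norm N.

Lemma dist_le x (A : set V) a : A a -> dist N x A <= N (x - a).
Proof.
move=> Aa; apply: ge_inf; last by exists a.
by exists 0 => _ [y _ <-]; exact: norm_ge0.
Qed.

Lemma le_dist x (A : set V) c : A !=set0 ->
  (forall a, A a -> c <= N (x - a)) -> c <= dist N x A.
Proof.
move=> [a Aa] h; apply: lb_le_inf; first by exists (N (x - a)), a.
by move=> _ [y Ay <-]; exact: h.
Qed.

Lemma dist_lt x (A : set V) c : A !=set0 -> dist N x A < c ->
  exists2 a, A a & N (x - a) < c.
Proof.
move=> A0 h; apply: contrapT => noa; have : c <= dist N x A.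
  apply: le_dist => // a Aa; rewrite leNgt; apply/negP => ac.
  by apply: noa; exists a.
by rewrite leNgt h.
Qed.
End distances.

(** * Vectors of equal norm in the plane *)

Lemma seq_least (T : eqType) (e : rel T) (S : seq T) :
  {in S &, total e} -> {in S & &, transitive e} -> S != [::] ->
  exists2 p, p \in S & {in S, forall s, e p s}.
Proof.
move=> tot tr; case: S tot tr => // x S + + _.
elim: S x => [|y S IH] x tot tr.
  exists x; rewrite ?mem_head // => s; rewrite inE => /eqP ->.
  by have := tot x x; rewrite !mem_head orbb; apply.
have sub : {subset y :: S <= x :: y :: S}.
  by move=> z; rewrite (in_cons x) => ->; rewrite orbT.
have [||p pS pP] := IH y.
- by move=> a b /sub aS /sub bS; exact: tot.
- by move=> a b c /sub aS /sub bS /sub cS; exact: tr.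
have xS : x \in x :: y :: S := mem_head _ _.
have /orP[xp|px] := tot x p xS (sub _ pS).
  exists x => // s; rewrite in_cons => /predU1P[->|sS].
    by have := tot x x xS xS; rewrite orbb.
  by apply: (tr p) => //; [exact: sub | exact: sub | exact: pP].
exists p; first exact: sub.
by move=> s; rewrite in_cons => /predU1P[->|/pP].
Qed.

Section plane.
Context (R : realType).
Local Notation V := 'rV[R]_2.
Implicit Types (x y p q s v : V) (N : V -> R).

Lemma row2P x y : x 0 0 = y 0 0 -> x 0 1 = y 0 1 -> x = y.
Proof.
move=> h0 h1; apply/rowP => -[[|[|//]] j].
- by rewrite (_ : Ordinal j = 0); [exact: h0|exact: val_inj].
- by rewrite (_ : Ordinal j = 1); [exact: h1|exact: val_inj].
Qed.

Definition cross x y : R := x 0 0 * y 0 1 - x 0 1 * y 0 0.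

Lemma crossC x y : cross x y = - cross y x.
Proof. by rewrite /cross; ring. Qed.

(** Cramer's rule. When the three coefficients are nonnegative, it exhibits 0 as
    a nonnegative combination of the three vectors. *)
Lemma cross_dep x y z :
  cross y z *: x + cross z x *: y + cross x y *: z = 0.
Proof. by apply: row2P; rewrite !mxE /cross; ring. Qed.

(** Strict convexity: the triangle inequality is strict for linearly independent
    vectors. *)
Definition strict_norm N := forall x y, cross x y != 0 -> N (x + y) < N x + N y.

Section norm.
Variable N : V -> R.
Hypothesis nN : is_norm N.

(** Solving for [s0] leaves [a (s0 + s1) = (a - b) s1 - c s2], of norm at most
    [(a - b + c) r <= a r]. *)
Let pair_sorted r s0 s1 s2 (a b c : R) : N s1 = r -> N s2 = r ->
  0 <= c -> c <= b -> b <= a -> 0 < a ->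
  a *: s0 + b *: s1 + c *: s2 = 0 -> N (s0 + s1) <= r.
Proof.
move=> N1 N2 c0 cb ba a0 e0; rewrite -(ler_pM2l a0) -(normZ_ge0 nN) ?(ltW a0) //.
have -> : a *: (s0 + s1) = (a - b) *: s1 - c *: s2.
  move/eqP: e0; rewrite addr_eq0 => /eqP <-.
  by rewrite scalerDr scalerBl [RHS]addrC -addrA [b *: _ + _]addrC subrK.
apply: le_trans (normB_le nN _ _) _.
rewrite !(normZ_ge0 nN) ?subr_ge0 // N1 N2.
have : 0 <= r by rewrite -N1 norm_ge0.
nra.
Qed.

(** The two vectors with the largest coefficients form such a pair. *)
Lemma zero_comb_pair r s0 s1 s2 (a b c : R) : N s0 = r -> N s1 = r -> N s2 = r ->
  0 <= a -> 0 <= b -> 0 <= c -> 0 < a + b + c ->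
  a *: s0 + b *: s1 + c *: s2 = 0 ->
  [\/ N (s0 + s1) <= r, N (s1 + s2) <= r | N (s0 + s2) <= r].
Proof.
move=> N0 N1 N2 a0 b0 c0 abc e0.
have e1 : a *: s0 + c *: s2 + b *: s1 = 0.
  by rewrite -[RHS]e0; apply: row2P; rewrite !mxE; ring.
have e2 : b *: s1 + a *: s0 + c *: s2 = 0.
  by rewrite -[RHS]e0; apply: row2P; rewrite !mxE; ring.
have e3 : b *: s1 + c *: s2 + a *: s0 = 0.
  by rewrite -[RHS]e0; apply: row2P; rewrite !mxE; ring.
have e4 : c *: s2 + a *: s0 + b *: s1 = 0.
  by rewrite -[RHS]e0; apply: row2P; rewrite !mxE; ring.
have e5 : c *: s2 + b *: s1 + a *: s0 = 0.
  by rewrite -[RHS]e0; apply: row2P; rewrite !mxE; ring.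
have pos z : a <= z -> b <= z -> c <= z -> 0 < z by move=> *; lra.
have [ab|/ltW ba] := leP a b; have [bc|/ltW cb] := leP b c; have [ac|/ltW ca] := leP a c.
- apply: Or32; rewrite addrC; apply: pair_sorted e5 => //; apply: pos => //.
- apply: Or32; rewrite addrC; apply: pair_sorted e5 => //; apply: pos => //; lra.
- apply: Or32; apply: pair_sorted e3 => //; apply: pos => //; lra.
- apply: Or31; rewrite addrC; apply: pair_sorted e2 => //; apply: pos => //; lra.
- apply: Or33; rewrite addrC; apply: pair_sorted e4 => //; apply: pos => //; lra.
- apply: Or33; apply: pair_sorted e1 => //; apply: pos => //; lra.
- apply: Or31; apply: pair_sorted e0 => //; apply: pos => //; lra.
- apply: Or31; apply: pair_sorted e0 => //; apply: pos => //; lra.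
Qed.

(** The norm is convex along the line [s + R v]: being smaller than [r] on one
    side of [s], it is larger than [r] on the other. *)
Lemma outward_norm (r c e : R) s v : N s = r -> 0 < c -> N (s - c *: v) < r -> 0 < e ->
  r < N (s + e *: v).
Proof.
move=> Ns c0 Nc e0.
have : (c + e) * N s <= c * N (s + e *: v) + e * N (s - c *: v).
  rewrite -!(normZ_ge0 nN) ?(ltW e0) ?(ltW c0) ?(ltW (addr_gt0 c0 e0)) //.
  apply: le_trans (is_normD nN _ _); rewrite le_eqVlt; apply/orP; left; apply/eqP.
  by congr N; apply: row2P; rewrite !mxE; ring.
by rewrite Ns => h; rewrite -(ltr_pM2l c0); nra.
Qed.

(** Parallel vectors on a sphere are equal or opposite, and the last hypothesis
    excludes the second case. *)
Lemma parallel_sphere r p s : 0 < r -> N p = r -> N s = r -> cross p s = 0 ->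
  r < N (p + s) -> s = p.
Proof.
move=> r0 Np Ns ps psr.
have [k sE] : exists k, s = k *: p.
  have [p0|p0] := eqVneq (p 0 0) 0.
    have p1 : p 0 1 != 0.
      apply: contraTneq r0 => p1; rewrite -Np (_ : p = 0) ?norm0 ?ltxx //.
      by apply: row2P; rewrite !mxE.
    exists (s 0 1 / p 0 1); apply: row2P; rewrite !mxE ?divfK //.
    move: ps; rewrite /cross p0 mul0r sub0r mulr0 => /eqP.
    by rewrite oppr_eq0 mulf_eq0 (negPf p1) => /eqP.
  exists (s 0 0 / p 0 0); apply: row2P; rewrite !mxE ?divfK //.
  apply: (mulfI p0); move/eqP: ps; rewrite /cross subr_eq0 => /eqP ->.
  by field.
have k1 : `|k| = 1.
  by apply: (mulIf (lt0r_neq0 r0)); rewrite mul1r -{1}Np -(is_normZ nN) -sE.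
have := eqr_norm2 k 1; rewrite k1 normr1 eqxx => /esym/orP[] /eqP kE.
  by rewrite sE kE scale1r.
by move: psr; rewrite sE kE scaleN1r subrr norm0 // ltNge ltW.
Qed.

Hypothesis sN : strict_norm N.

(** Since [g (p + q) = s + (g - d) q], the vector [s - (g / 2) (p + q)] is
    [s / 2 - ((g - d) / 2) q], and [g - d <= 1] because [s] has norm [r]. If
    [g = d] it is [s / 2]; otherwise its norm is at most [r], and strictly less
    by strict convexity. *)
Lemma cone_inward r p q s (g d : R) : N p = r -> N q = r -> N s = r -> 0 < r ->
  0 <= d -> d <= g -> cross p q != 0 -> s = g *: p + d *: q ->
  exists2 c, 0 < c & N (s - c *: (p + q)) < r.
Proof.
move=> Np Nq Ns r0 d0 dg cpq sE.
have g0 : 0 < g.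
  rewrite lt_def (le_trans d0 dg) andbT; apply/eqP => g0.
  have d00 : d = 0 by apply: le_anti; rewrite d0 -g0 dg.
  by move: Ns; rewrite sE g0 d00 !scale0r addr0 norm0 // => r00; rewrite -r00 ltxx in r0.
exists (g / 2); first by rewrite divr_gt0.
have -> : s - (g / 2) *: (p + q) = 2^-1 *: s + - (((g - d) / 2) *: q).
  by rewrite sE; apply: row2P; rewrite !mxE; field.
have gd1 : g - d <= 1.
  rewrite -(ler_pM2r r0) mul1r mulrBl.
  have := le_normB nN (g *: p) (- (d *: q)).
  by rewrite opprK (normN nN) -sE !(normZ_ge0 nN) ?(le_trans d0 dg) // Np Nq Ns.
have [gd|gd] := eqVneq g d.
  rewrite gd subrr mul0r scale0r subr0 normZ_ge0 // Ns; lra.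
have gltd : 0 < g - d by rewrite subr_gt0 lt_def gd dg.
apply: lt_le_trans (_ : N (2^-1 *: s) + N (- (((g - d) / 2) *: q)) <= _).
  apply: sN.
  rewrite (_ : cross _ _ = - (g * ((g - d) / 4) * cross p q)); last first.
    by rewrite sE /cross !mxE; field.
  by rewrite oppr_eq0 !mulf_neq0 // ?gt_eqF // divr_gt0.
rewrite (normN nN) !(normZ_ge0 nN) ?Ns ?Nq; [nra|lra|lra].
Qed.
End norm.
End plane.
Section escape.
Context (R : realType).
Local Notation V := 'rV[R]_2.
Variable N : V -> R.
Hypotheses (nN : is_norm N) (sN : strict_norm N).
Implicit Types (p q s v : V).

(** * A direction leading away from all nearest points *)

(** No nontrivial nonnegative combination of three elements of [S] vanishes, so
    the sign of [cross] is a total preorder on [S]. Its extreme elements [p] and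
    [q] span a cone containing [S], and [p + q] is the required direction. *)
Lemma escape_direction (r : R) (S : seq V) : 0 < r -> S != [::] ->
  {in S, forall s, N s = r} -> {in S &, forall p q, r < N (p + q)} ->
  exists v, {in S, forall s, forall e, 0 < e -> r < N (s + e *: v)}.
Proof.
move=> r0 S0 Sr Spq.
have trans s p t : s \in S -> p \in S -> t \in S ->
    0 <= cross s p -> 0 <= cross p t -> 0 <= cross s t.
  move=> sS pS tS sp pt; rewrite leNgt; apply/negP => st.
  have ts : 0 < cross t s by rewrite crossC oppr_gt0.
  have [||||] := zero_comb_pair nN (Sr _ sS) (Sr _ pS) (Sr _ tS) pt (ltW ts) sp.
  - lra.
  - exact: cross_dep.
  - by rewrite leNgt Spq.
  - by rewrite leNgt Spq.
  - by rewrite leNgt Spq.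
have tot s t : (0 <= cross s t) || (0 <= cross t s).
  by rewrite (crossC t) oppr_ge0 le_total.
have [||p pS pP] := @seq_least _ (fun s t => 0 <= cross s t) S _ _ S0.
- by move=> s t _ _; exact: tot.
- by move=> p s t pS sS tS; exact: trans.
have [||q qS qP] := @seq_least _ (fun s t => 0 <= cross t s) S _ _ S0.
- by move=> s t _ _; exact: tot.
- by move=> p' s t pS' sS tS h h'; exact: (trans t p' s).
exists (p + q) => s sS e e0.
have [Ns Np Nq] : [/\ N s = r, N p = r & N q = r] by split; exact: Sr.
suff [c c0 Nc] : exists2 c, 0 < c & N (s - c *: (p + q)) < r.
  exact: (outward_norm nN Ns c0 Nc e0).
have ps := pP _ sS; have sq := qP _ sS; have pq := pP _ qS.
move: pq; rewrite le_eqVlt => /predU1P[pq|pq]; last first.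
  pose g := cross s q / cross p q; pose d := cross p s / cross p q.
  have sE : s = g *: p + d *: q.
    apply: (scalerI (lt0r_neq0 pq)); rewrite scalerDr !scalerA.
    rewrite ![cross p q * _]mulrC !divfK ?gt_eqF //.
    by apply: row2P; rewrite !mxE /cross; ring.
  have g0 : 0 <= g by rewrite divr_ge0 // ltW.
  have d0 : 0 <= d by rewrite divr_ge0 // ltW.
  have [dg|/ltW gd] := leP d g.
    exact: (cone_inward nN sN Np Nq Ns r0 d0 dg (lt0r_neq0 pq) sE).
  rewrite [p + q]addrC; apply: (cone_inward nN sN Nq Np Ns r0 g0 gd _ _).
    by rewrite crossC oppr_eq0 gt_eqF.
  by rewrite addrC.
have qE : q = p by apply: (parallel_sphere nN r0 _ _ _ (Spq _ _ pS qS)).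
have sE : s = p.
  apply: (parallel_sphere nN r0 _ _ _ (Spq _ _ pS sS)) => //.
  by apply: le_anti; rewrite ps andbT -oppr_ge0 -crossC -[X in cross s X]qE.
exists 2^-1; first by rewrite invr_gt0.
rewrite sE qE (_ : p - _ = 0) ?norm0 //.
by apply: row2P; rewrite !mxE; field.
Qed.
End escape.

(** * Birkhoff orthogonality *)

Section orthogonal.
Context (R : realType).

(** A one-sided bound suffices, since [x] and [y] can be exchanged. *)
Lemma lipschitz_continuous (U : normedModType R) (f : U -> R) (L : R) :
  (forall x y, f x - f y <= L * `|x - y|) -> continuous f.
Proof.
move=> fL x; apply/cvgrPdist_le => e e0; near=> y.
have L0 : 0 < `|L| + 1 by rewrite ltr_wpDl.
apply: (@le_trans _ _ (`|L| * `|x - y|)).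
  rewrite ler_norml; apply/andP; split.
    rewrite lerNl opprB; apply: le_trans (fL y x) _.
    by rewrite distrC ler_wpM2r // ler_norm.
  by apply: le_trans (fL x y) _; rewrite ler_wpM2r // ler_norm.
apply: (@le_trans _ _ ((`|L| + 1) * `|x - y|)); first by rewrite ler_wpM2r // lerDl.
rewrite mulrC -ler_pdivlMr //.
by near: y; apply: cvgr_dist_le; [exact: cvg_id | rewrite divr_gt0].
Unshelve. all: by end_near.
Qed.

(** The vector [g + s0 e] is Birkhoff orthogonal to [e]. The minimum is searched
    on a compact interval: for [|s| > 2 N g / N e] the vector [g + s e] is longer
    than [g]. *)
Lemma birkhoff_orthogonal (V : lmodType R) (N : V -> R) (e g : V) :
  is_norm N -> e != 0 -> exists s0 : R, forall s : R, N (g + s0 *: e) <= N (g + s *: e).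
Proof.
move=> nN e0; have Ne := norm_gt0 nN e0.
pose K := 2 * N g / N e.
have K0 : 0 <= K by rewrite divr_ge0 ?mulr_ge0 ?(norm_ge0 nN).
have [||s0 sK smin] := @EVT_min R (fun s => N (g + s *: e)) (- K) K.
- lra.
- apply: continuous_subspaceT; apply: (@lipschitz_continuous _ _ (N e)) => x y.
  apply: le_trans (le_normB nN _ _) _.
  by rewrite opprD addrACA subrr add0r -scalerBl (is_normZ nN) mulrC.
exists s0 => s; have [sin|] := boolP (s \in `[- K, K]); first exact: smin.
rewrite in_itv /= -ler_norml -ltNge => Ks.
apply: (@le_trans _ _ (N (g + 0 *: e))).
  by apply: smin; rewrite in_itv /= lerNl oppr0 K0.
rewrite scale0r addr0.
have := le_normB nN (s *: e) (- g).
rewrite opprK (normN nN) (is_normZ nN) [s *: e + _]addrC.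
move: Ks; rewrite /K ltr_pdivrMr //; lra.
Qed.

Lemma orthogonal_norm_ge (V : lmodType R) (N : V -> R) (e f : V) :
  is_norm N -> (forall s : R, N f <= N (f + s *: e)) ->
  forall s t : R, `|t| * N f <= N (t *: f + s *: e).
Proof.
move=> nN h s t; have [->|t0] := eqVneq t 0; first by rewrite normr0 mul0r norm_ge0.
rewrite (_ : _ + _ = t *: (f + (s / t) *: e)); last first.
  by rewrite scalerDr scalerA mulrC divfK.
by rewrite (is_normZ nN) ler_wpM2l.
Qed.

End orthogonal.

(** * Comparison with the Euclidean norm, strict convexity *)

Section plane_norms.
Context (R : realType).
Local Notation V := 'rV[R]_2.
Implicit Types (x y : V) (N : V -> R).

Lemma row2E x : x = x 0 1 *: delta_mx 0 1 + x 0 0 *: delta_mx 0 0.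
Proof. by apply: row2P; rewrite !mxE /= ?mulr1 ?mulr0 ?addr0 ?add0r. Qed.

(** One half of the equivalence of norms: in a basis [e], [f] with [f] orthogonal
    to [e], the second coordinate is controlled by orthogonality, and then the
    first one by the triangle inequality. *)
Lemma norm_coord_bound N : is_norm N ->
  exists2 C, 0 < C & forall x, `|x 0 0| + `|x 0 1| <= C * N x.
Proof.
move=> nN; pose e : V := delta_mx 0 0; pose g : V := delta_mx 0 1.
have e0 : e != 0.
  by apply/eqP => /matrixP /(_ 0 0)/eqP; rewrite !mxE /= oner_eq0.
have [s0 hs] := birkhoff_orthogonal g nN e0.
set f := g + s0 *: e in hs.
have f0 : f != 0.
  by apply/eqP => /matrixP /(_ 0 1)/eqP; rewrite !mxE /= mulr0 addr0 oner_eq0.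
have Ne := norm_gt0 nN e0; have Nf := norm_gt0 nN f0.
have hf s : N f <= N (f + s *: e) by rewrite -addrA -scalerDl.
have x1N x : `|x 0 1| <= N x / N f.
  rewrite ler_pdivlMr // {2}(row2E x).
  rewrite (_ : _ + _ = x 0 1 *: f + (x 0 0 - x 0 1 * s0) *: e); last first.
    by apply: row2P; rewrite !mxE /=; ring.
  exact: orthogonal_norm_ge.
have x0N x : `|x 0 0| <= (1 + N g / N f) * N x / N e.
  rewrite ler_pdivlMr // -(is_normZ nN).
  have -> : x 0 0 *: e = x - x 0 1 *: g by rewrite {2}(row2E x) addrC addKr.
  apply: le_trans (normB_le nN _ _) _; rewrite (is_normZ nN) mulrDl mul1r lerD2l.
  have := ler_wpM2r (norm_ge0 nN g) (x1N x).
  by rewrite mulrAC [N x * _]mulrC mulrAC.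
exists ((1 + N g / N f) / N e + (N f)^-1).
  by rewrite ltr_wpDl ?invr_gt0 // divr_ge0 ?addr_ge0 ?divr_ge0 ?(norm_ge0 nN).
by move=> x; rewrite mulrDl lerD // ?[_^-1 * _]mulrC // mulrAC.
Qed.

Definition euclid x : R := Num.sqrt (x 0 0 ^+ 2 + x 0 1 ^+ 2).

Lemma euclid_ge0 x : 0 <= euclid x. Proof. exact: sqrtr_ge0. Qed.

Lemma euclid_sqr x : euclid x ^+ 2 = x 0 0 ^+ 2 + x 0 1 ^+ 2.
Proof. by rewrite sqr_sqrtr // addr_ge0 // sqr_ge0. Qed.

Definition dot x y := x 0 0 * y 0 0 + x 0 1 * y 0 1.

(** Lagrange's identity: it gives the Cauchy-Schwarz inequality, and shows that
    it is strict for independent vectors. *)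
Lemma dot_cross x y : (euclid x * euclid y) ^+ 2 = dot x y ^+ 2 + cross x y ^+ 2.
Proof. by rewrite exprMn !euclid_sqr /dot /cross; ring. Qed.

Lemma euclid_sqrD x y : euclid (x + y) ^+ 2 = euclid x ^+ 2 + euclid y ^+ 2 + 2 * dot x y.
Proof. by rewrite !euclid_sqr /dot !mxE; ring. Qed.

Lemma euclid_is_norm : is_norm euclid.
Proof.
split.
- move=> x y; rewrite -(ler_pXn2r (ltn0Sn 1)) ?nnegrE ?addr_ge0 ?euclid_ge0 //.
  have := dot_cross x y; rewrite euclid_sqrD.
  have := mulr_ge0 (euclid_ge0 x) (euclid_ge0 y); nra.
- move=> c x; rewrite /euclid !mxE !exprMn -mulrDr sqrtrM ?sqr_ge0 //.
  by rewrite sqrtr_sqr.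
- move=> x /eqP; rewrite sqrtr_eq0 => h.
  have [h0 h1] := (sqr_ge0 (x 0 0), sqr_ge0 (x 0 1)).
  by apply: row2P; rewrite mxE; apply/eqP; rewrite -sqrf_eq0; apply/eqP; lra.
Qed.

Lemma euclid_strict : strict_norm euclid.
Proof.
move=> x y xy; rewrite -(ltr_pXn2r (ltn0Sn 1)) ?nnegrE ?addr_ge0 ?euclid_ge0 //.
have cp : 0 < cross x y ^+ 2 by rewrite exprn_even_gt0.
have := dot_cross x y; rewrite euclid_sqrD.
have := mulr_ge0 (euclid_ge0 x) (euclid_ge0 y); nra.
Qed.

Lemma euclid_le x : euclid x <= `|x 0 0| + `|x 0 1|.
Proof.
rewrite -(ler_pXn2r (ltn0Sn 1)) ?nnegrE ?addr_ge0 ?euclid_ge0 //.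
rewrite euclid_sqr -(real_normK (num_real (x 0 0))) -(real_normK (num_real (x 0 1))).
have := mulr_ge0 (normr_ge0 (x 0 0)) (normr_ge0 (x 0 1)); nra.
Qed.

Lemma add_euclid_is_norm N k : is_norm N -> 0 <= k ->
  is_norm (fun x => N x + k * euclid x).
Proof.
move=> nN k0; have nE := euclid_is_norm; split.
- move=> x y; have := is_normD nN x y; have := ler_wpM2l k0 (is_normD nE x y); lra.
- by move=> c x; rewrite (is_normZ nN) (is_normZ nE); ring.
- move=> x h; apply: (is_norm0_eq0 nN); apply: le_anti; rewrite norm_ge0 // andbT.
  have := mulr_ge0 k0 (euclid_ge0 x); lra.
Qed.

Lemma add_euclid_strict N k : is_norm N -> 0 < k ->
  strict_norm (fun x => N x + k * euclid x).
Proof.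
move=> nN k0 x y xy; have := is_normD nN x y.
have := euclid_strict xy; rewrite -(ltr_pM2l k0); lra.
Qed.

End plane_norms.

(** * Convex combinations of few points *)

Section caratheodory.
Context (R : realType).

Definition is_comb (V : lmodType R) (A : set V) (b : V) (n : nat) :=
  exists (a : 'I_n -> V) (t : 'I_n -> R),
    [/\ forall i, A (a i), forall i, 0 <= t i, \sum_i t i = 1 &
        b = \sum_i t i *: a i].

Definition affinely_free (V : lmodType R) n (a : 'I_n -> V) :=
  forall u : 'I_n -> R, \sum_i u i = 0 -> \sum_i u i *: a i = 0 -> forall i, u i = 0.

Lemma convex_hull_comb (V : lmodType R) (A : set V) b :
  convex_hull A b -> exists n, is_comb A b n.
Proof.
apply: (@smallest_sub _ _ _ [set b | exists n, is_comb A b n]); last first.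
  move=> x Ax; exists 1, (fun=> x), (fun=> 1); split => //.
    by rewrite big_ord1.
  by rewrite big_ord1 scale1r.
move=> x y l /set_mem[n [a [t [Aa t0 t1 ->]]]] /set_mem[m [c [s [Ac s0 s1 ->]]]].
apply/mem_set; exists (n + m)%N.
exists (fun i : 'I_(n + m) => match fintype.split i with inl j => a j | inr j => c j end).
exists (fun i : 'I_(n + m) => match fintype.split i with
  | inl j => l%:num * t j | inr j => (1 - l%:num) * s j end).
have splitl (j : 'I_n) : fintype.split (lshift m j) = inl j := unsplitK (inl j).
have splitr (j : 'I_m) : fintype.split (rshift n j) = inr j := unsplitK (inr j).
split.
- by move=> i; case: (fintype.split i).
- by move=> i; case: (fintype.split i) => j; rewrite mulr_ge0 // subr_ge0.
- rewrite big_split_ord /=.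
  under eq_bigr do rewrite splitl; under [X in _ + X]eq_bigr do rewrite splitr.
  by rewrite -!mulr_sumr t1 s1 !mulr1 addrC subrK.
- rewrite big_split_ord /=.
  under [X in _ = X + _]eq_bigr do rewrite splitl -scalerA.
  under [X in _ = _ + X]eq_bigr do rewrite splitr -scalerA.
  by rewrite -!scaler_sumr.
Qed.

(** Subtracting from [t] the largest multiple of [u] that keeps all weights
    nonnegative annihilates one of them. *)
Lemma comb_reduce (V : lmodType R) (A : set V) b n
    (a : 'I_n.+1 -> V) (t u : 'I_n.+1 -> R) :
  (forall i, A (a i)) -> (forall i, 0 <= t i) -> \sum_i t i = 1 ->
  b = \sum_i t i *: a i ->
  \sum_i u i = 0 -> \sum_i u i *: a i = 0 -> (exists i, 0 < u i) -> is_comb A b n.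
Proof.
move=> Aa t0 t1 bE u0 ua0 [i0 ui0].
case: (@arg_minP _ _ _ i0 (fun i => 0 < u i) (fun i => t i / u i) ui0) => j uj jmin.
pose k := t j / u j; pose t' i := t i - k * u i.
have k0 : 0 <= k by rewrite divr_ge0 // ltW.
have t'j : t' j = 0 by rewrite /t' /k divfK ?subrr // gt_eqF.
have t'0 i : 0 <= t' i.
  rewrite subr_ge0; have [ui|ui] := ltP 0 (u i).
    by rewrite -ler_pdivlMr //; exact: jmin.
  by apply: le_trans (t0 i); rewrite mulr_ge0_le0.
have t'1 : \sum_i t' i = 1 by rewrite sumrB -mulr_sumr u0 mulr0 subr0.
have t'b : \sum_i t' i *: a i = b.
  under eq_bigr do rewrite scalerBl -scalerA.
  by rewrite sumrB -scaler_sumr ua0 scaler0 subr0 bE.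
exists (a \o lift j), (t' \o lift j); split => //=.
- by apply: etrans t'1; rewrite [RHS](bigD1_ord j) //= t'j add0r.
- by rewrite -t'b [LHS](bigD1_ord j) //= t'j scale0r add0r.
Qed.

(** A representation with the fewest points admits no affine dependency, by
    [comb_reduce]. *)
Lemma caratheodory (V : lmodType R) (A : set V) b : convex_hull A b ->
  exists n (a : 'I_n -> V) (t : 'I_n -> R),
    [/\ forall i, A (a i), forall i, 0 <= t i, \sum_i t i = 1,
        b = \sum_i t i *: a i & affinely_free a].
Proof.
move=> /convex_hull_comb[n0 cn0].
have ex : exists n, `[< is_comb A b n >] by exists n0; exact/asboolP.
case: (ex_minnP ex) => n /asboolP[a [t [Aa t0 t1 bE]]] nmin.
exists n, a, t; split => // u u0 ua0 i; apply/eqP; apply: contrapT => /negP ui.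
case: n => [|n] in a t Aa t0 t1 bE nmin u u0 ua0 i ui *; first by case: i ui.
suff /asboolP/nmin : is_comb A b n by rewrite ltnn.
have [ui0|ui0] := ltP 0 (u i).
  by apply: (comb_reduce Aa t0 t1 bE u0 ua0); exists i.
apply: (comb_reduce Aa t0 t1 bE (u := fun i => - u i)).
- by rewrite sumrN u0 oppr0.
- by under eq_bigr do rewrite scaleNr; rewrite sumrN ua0 oppr0.
- by exists i; rewrite oppr_gt0 lt_def eq_sym ui.
Qed.

(** Row [i] is [(1, a i)], so that affine dependencies are the elements of the
    left kernel. *)
Let affine_mx n (a : 'I_n -> 'rV[R]_2) : 'M[R]_(n, 1 + 2) :=
  row_mx (const_mx 1) (\matrix_i a i).

Let mul_affine_mx n (a : 'I_n -> 'rV[R]_2) (u : 'rV[R]_n) :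
  u *m affine_mx a = row_mx (\sum_i u 0 i)%:M (\sum_i u 0 i *: a i).
Proof.
rewrite mul_mx_row; congr row_mx.
  apply/rowP => j; rewrite !mxE (ord1 j) eqxx mulr1n.
  by apply: eq_bigr => i _; rewrite mxE mulr1.
by rewrite mulmx_sum_row; apply: eq_bigr => i _; rewrite rowK.
Qed.

Let affinely_free_row_free n (a : 'I_n -> 'rV[R]_2) :
  affinely_free a -> row_free (affine_mx a).
Proof.
move=> afree; apply: inj_row_free => u.
rewrite mul_affine_mx => /eqP; rewrite row_mx_eq0 => /andP[/eqP u0 /eqP ua0].
apply/rowP => i; rewrite mxE.
apply: (afree (fun i => u 0 i)) => //.
by move/matrixP/(_ 0 0) : u0; rewrite !mxE eqxx mulr1n.
Qed.

Lemma affinely_free_le3 n (a : 'I_n -> 'rV[R]_2) : affinely_free a -> (n <= 3)%N.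
Proof.
by move=> /affinely_free_row_free /eqP <-; exact: rank_leq_col.
Qed.

Lemma affinely_free_span n (a : 'I_n -> 'rV[R]_2) (v : 'rV[R]_2) :
  affinely_free a -> n = 3%N ->
  exists2 u : 'I_n -> R, \sum_i u i = 0 & v = \sum_i u i *: a i.
Proof.
move=> + n3; rewrite n3 in a *.
move=> /affinely_free_row_free; rewrite row_free_unit => aU.
pose w : 'rV[R]_(1 + 2) := row_mx 0 v.
have := mul_affine_mx a (w *m invmx (affine_mx a)).
rewrite mulmxKV // => /eq_row_mx[/matrixP/(_ 0 0) e0 e1].
exists (fun i => (w *m invmx (affine_mx a)) 0 i) => //.
by move: e0; rewrite !mxE eqxx mulr1n => <-.
Qed.

End caratheodory.

(** * Maxima over a simplex *)

Section simplex.
Context (R : realType).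

Definition simplex n (t : 'I_n -> R) := (forall i, 0 <= t i) /\ \sum_i t i = 1.

Lemma entry_le_norm n (v : 'rV[R]_n) i : `|v 0 i| <= `|v|.
Proof.
rewrite [leRHS]mx_normrE.
by rewrite (le_bigmax_cond _ (fun j : 'I_1 * 'I_n => `|v j.1 j.2|) (j := (0, i))).
Qed.

Lemma compact_simplex n : compact [set v : 'rV[R]_n | simplex (v 0)].
Proof.
have -> : [set v : 'rV[R]_n | simplex (v 0)] =
    [set v : 'rV[R]_n | \sum_i v 0 i = 1] `&`
    [set v | forall i, `[0, 1]%classic (v ord0 i)].
  apply/seteqP; split => v /=.
    move=> [v0 v1]; split => // i; rewrite in_itv /= v0 /= -v1.
    by rewrite (bigD1 i) //= lerDl sumr_ge0.
  by move=> [v1 v0]; split => // i; have := v0 i; rewrite /= in_itv /= => /andP[].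
rewrite setIC; apply: compact_closedI.
  by apply: (@rV_compact R n (fun=> `[0, 1]%classic)) => i; exact: segment_compact.
apply: (@closed_comp _ _ (fun v : 'rV[R]_n => \sum_i v 0 i) [set x | x = 1]);
  last exact: closed_eq.
move=> v _; apply: (@lipschitz_continuous R _ _ n%:R) => x y.
rewrite -sumrB; apply: (@le_trans _ _ (\sum_(i < n) `|x - y|)).
  apply: ler_sum => i _; apply: le_trans (ler_norm _) _.
  by have := entry_le_norm (x - y) i; rewrite !mxE.
by rewrite sumr_const card_ord mulr_natl.
Qed.

(** Weights are functions rather than row vectors, so that maps defined through
    arbitrary norms of combinations only have to be Lipschitz in the weights. *)
Lemma simplex_max n (f : ('I_n -> R) -> R) (L : 'I_n -> R) :
  (forall t s, f t - f s <= \sum_i L i * `|t i - s i|) ->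
  (exists t : 'I_n -> R, simplex t) ->
  exists2 t, simplex t & forall s, simplex s -> f s <= f t.
Proof.
move=> fL [t0 st0].
pose row (t : 'I_n -> R) : 'rV[R]_n := \row_i t i.
have rowE t : row t 0 = t by apply/funext => i; rewrite mxE.
have [|||v /set_mem sv vmax] := 
  @EVT_max_rV R n (fun v => f (v 0)) [set v | simplex (v 0)].
- by exists (row t0); rewrite /= rowE.
- exact: compact_simplex.
- apply: continuous_subspaceT.
  apply: (@lipschitz_continuous R _ _ (\sum_i `|L i|)) => x y.
  apply: le_trans (fL _ _) _; rewrite mulr_suml; apply: ler_sum => i _.
  apply: (@le_trans _ _ (`|L i| * `|x 0 i - y 0 i|)).
    by rewrite ler_wpM2r // ler_norm.
  by apply: ler_wpM2l => //; have := entry_le_norm (x - y) i; rewrite !mxE.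
exists (v 0) => // s ss; have := vmax (row s); rewrite rowE; apply.
by apply/mem_set; rewrite /= rowE.
Qed.

Lemma small_scale (J : finType) (f g : J -> R) : (forall j, 0 < f j) ->
  exists2 e, 0 < e & forall j, e * g j < f j.
Proof.
move=> f0; pose s := \sum_j `|g j| / f j.
have s0 : 0 <= s by apply: sumr_ge0 => j _; rewrite divr_ge0 // ltW.
have s1 : 0 < 1 + s by rewrite ltr_pwDl.
exists (1 + s)^-1; first by rewrite invr_gt0.
move=> j; rewrite mulrC ltr_pdivrMr //.
have : `|g j| / f j <= s.
  by rewrite /s (bigD1 j) //= lerDl sumr_ge0 // => k _; rewrite divr_ge0 // ltW.
rewrite ler_pdivrMr // => h; have := ler_norm (g j); have := f0 j; nra.
Qed.

End simplex.
(** * The bound for finite sets and strictly convex norms *)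

Lemma simplex3_gt0 (R : realType) n (w : 'I_n -> R) : n = 3%N ->
  \sum_i w i = 1 -> (forall i, w i < 2^-1) -> forall i, 0 < w i.
Proof.
move=> n3; rewrite n3 in w *; rewrite !big_ord_recl big_ord0 => w1 wlt.
have := wlt ord0; have := wlt (lift ord0 ord0); have := wlt (lift ord0 (lift ord0 ord0)).
move=> h2 h1 h0; case=> -[|[|[|//]]] i.
- by rewrite (_ : Ordinal i = ord0); [lra|exact: val_inj].
- by rewrite (_ : Ordinal i = lift ord0 ord0); [lra|exact: val_inj].
- by rewrite (_ : Ordinal i = lift ord0 (lift ord0 ord0)); [lra|exact: val_inj].
Qed.

Section finite_bound.
Context (R : realType).
Local Notation V := 'rV[R]_2.
Variables (N : V -> R) (I : finType) (F : I -> V) (n : nat) (a : 'I_n -> V).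
Hypotheses (nN : is_norm N) (sN : strict_norm N) (freea : affinely_free a).

Let pt (t : 'I_n -> R) : V := \sum_i t i *: a i.

Definition nearest (x : V) (i : I) := forall k, N (x - F i) <= N (x - F k).

Variables (io : 'I_n -> I) (c : R).
Hypothesis aF : forall j, F (io j) = a j.
Hypothesis midF : forall s t i j, simplex s -> simplex t ->
  nearest (pt s) i -> nearest (pt t) j ->
  exists k, N (2^-1 *: (F i + F j) - F k) <= c.

(** The hypothesis [midF] is approximate convexity restricted to the pairs that
    the argument meets, namely points of [F] nearest to points of the triangle;
    this locality is what lets a net of a bounded part of a set inherit it. *)
Lemma finite_bound (t : 'I_n -> R) : simplex t -> exists i, N (pt t - F i) <= 2 * c.
Proof.
move=> st.
have [j0] : exists j : 'I_n, True.
  case: (n) t st => [t [_]|m _ _]; last by exists ord0.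
  by rewrite big_ord0 => /esym/eqP; rewrite oner_eq0.
move=> _.
pose near (x : V) : I := [arg min_(i < io j0) N (x - F i)]%O.
have nearP x : nearest x (near x).
  by rewrite /near; case: arg_minP => // i _ h k; exact: h.
pose f (t : 'I_n -> R) := N (pt t - F (near (pt t))).
have f_le s k : f s <= N (pt s - F k) by exact: nearP.
have ptB s u e : pt (fun i => s i + e * u i) = pt s + e *: pt u.
  by rewrite /pt scaler_sumr -big_split; apply: eq_bigr => i _; rewrite scalerDl scalerA.
have [||w sw wmax] := @simplex_max R n f (fun i => N (a i)).
- move=> s u; rewrite lerBlDr.
  apply: le_trans (f_le s (near (pt u))) _.
  apply: le_trans (norm_dist_le nN _ (pt u) _) _.
  rewrite lerD2r /pt -sumrB; apply: le_trans (norm_sum nN _) _.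
  by apply: ler_sum => i _; rewrite -scalerBl (is_normZ nN) mulrC.
- by exists t.
set b := pt w; set r := f w.
suff rc : r <= 2 * c by exists (near (pt t)); exact: le_trans (wmax _ st) rc.
rewrite leNgt; apply/negP => cr.
have r_le k : r <= N (b - F k) by exact: f_le.
have [w0 w1] := sw.
have r0 : 0 < r.
  have [k] := midF sw sw (nearP b) (nearP b).
  by have := norm_ge0 nN (2^-1 *: (F (near b) + F (near b)) - F k); lra.
have far s u i j : simplex s -> simplex u -> nearest (pt s) i -> nearest (pt u) j ->
    r / 2 < N (b - 2^-1 *: (F i + F j)).
  move=> ss su si uj; have [k kc] := midF ss su si uj.
  by have := r_le k; have := norm_dist_le nN b (2^-1 *: (F i + F j)) (F k); lra.
(* A weight at least 1/2 keeps the reflection of [b] through [a i] inside the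
   triangle; [s] are its weights and [d] those of [a i]. *)
have [[i wi]|wlt] := pselect (exists i, 2^-1 <= w i).
  pose d j : R := (j == i)%:R.
  have sumd (G : 'I_n -> V) : \sum_j d j *: G j = G i.
    rewrite (bigD1 i) //= /d eqxx scale1r big1 ?addr0 // => j /negPf ->.
    by rewrite scale0r.
  have sd : simplex d.
    split=> [j|]; first by rewrite /d ler0n.
    rewrite (bigD1 i) //= /d eqxx big1 ?addr0 // => j /negPf ->.
    by [].
  have nd : nearest (pt d) (io i).
    by move=> k; rewrite /pt sumd aF subrr norm0 // norm_ge0.
  pose s j := w j + (w j - d j).
  have ss : simplex s.
    split=> [j|]; last by rewrite /s big_split sumrB /= w1 sd.2 subrr addr0.
    rewrite /s /d; have [->|_] := eqVneq j i; first by rewrite /=; lra.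
    by have := w0 j; rewrite subr0; lra.
  have ptsE : pt s = b + (b - a i).
    rewrite /pt /s -(sumd a) -sumrB -big_split /=.
    by apply: eq_bigr => j _; rewrite scalerDl scalerBl.
  have := far _ _ _ _ ss sd (nearP (pt s)) nd.
  have -> : b - 2^-1 *: (F (near (pt s)) + F (io i)) = 2^-1 *: (pt s - F (near (pt s))).
    by rewrite aF ptsE; apply: row2P; rewrite !mxE; field.
  by rewrite normZ_ge0 //; have := wmax _ ss; rewrite -/r /f; lra.
have {}wlt i : w i < 2^-1 by rewrite ltNge; apply/negP => wi; apply: wlt; exists i.
have n3 : n = 3%N.
  apply/eqP; rewrite eqn_leq (affinely_free_le3 freea) ltnNge; apply/negP => n2.
  have : 0 < \sum_(i < n) (2^-1 - w i).
    rewrite (bigD1 j0) //= ltr_pwDl ?subr_gt0 // sumr_ge0 // => i _.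
    by rewrite subr_ge0 ltW.
  rewrite sumrB w1 sumr_const card_ord -mulr_natl subr_gt0.
  by have : n%:R <= 2 :> R; [rewrite ler_nat | lra].
have wpos := simplex3_gt0 n3 w1 wlt.
pose S := [seq F i - b | i <- enum I & `[< nearest b i >]].
have inS i : nearest b i -> F i - b \in S.
  by move=> bi; apply: map_f; rewrite mem_filter mem_enum andbT; exact/asboolP.
have SP s : s \in S -> exists2 i, nearest b i & s = F i - b.
  by move=> /mapP[i]; rewrite mem_filter => /andP[/asboolP bi _] ->; exists i.
have [|||v vS] := @escape_direction _ _ nN sN r S r0.
- by apply/eqP => S0; have := inS _ (nearP b); rewrite S0.
- move=> _ /SP[i bi ->]; rewrite normBC //; apply: le_anti; rewrite r_le andbT.
  exact: bi.
- move=> _ _ /SP[i bi ->] /SP[j bj ->]; have := far _ _ _ _ sw sw bi bj.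
  rewrite normBC // -(ltr_pM2l (ltr0Sn R 1)) -(normZ_ge0 nN) //.
  rewrite mulrC divfK // scalerBr scalerA divff // scale1r scaler_nat mulr2n.
  by rewrite opprD addrACA.
have [u u0 vE] := affinely_free_span v freea n3.
(* The step [e] must keep the weights nonnegative and must not bring [b] within
   [r] of the points that are not nearest. *)
pose J := ('I_n + I)%type.
pose lhs (j : J) := match j with
  | inl i => u i
  | inr k => if `[< nearest b k >] then 0 else N v end.
pose rhs (j : J) := match j with
  | inl i => w i
  | inr k => if `[< nearest b k >] then 1 else N (F k - b) - r end.
have [|e e0 he] := @small_scale R J rhs lhs.
  case=> [i|k] /=; first exact: wpos.
  case: asboolP => // bk; rewrite subr_gt0 lt_def normBC // r_le andbT.
  by apply/eqP => rk; apply: bk => l; rewrite rk.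
pose s i := w i + - e * u i.
have ss : simplex s.
  split=> [i|]; last by rewrite /s big_split -mulr_sumr /= w1 u0 mulr0 addr0.
  by have := he (inl i); rewrite /= /s; lra.
have ptsE : pt s = b - e *: v by rewrite /s ptB scaleNr vE.
pose k := near (pt s).
have fsE : f s = N (F k - b + e *: v).
  by rewrite /f -/k normBC // ptsE opprB [e *: v - b]addrC addrA.
have := wmax _ ss; rewrite leNgt => /negP; apply; rewrite -/r fsE.
have := he (inr k); rewrite /=; case: asboolP => [bk _|_].
  exact: vS (inS _ bk) _ e0.
have := le_normB nN (F k - b) (- (e *: v)).
rewrite opprK (normN nN) normZ_ge0 ?(ltW e0) //.
lra.
Qed.

End finite_bound.
(** * The upper bound *)

Section upper.
Context (R : realType).
Local Notation V := 'rV[R]_2.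
Implicit Types (x y : V) (N : V -> R) (A : set V).

Lemma truncn_near (u v : R) : 0 <= u -> 0 <= v -> Num.truncn u = Num.truncn v ->
  `|u - v| < 1.
Proof.
move=> u0 v0 uv; have /andP[] := truncn_itv u0; have /andP[] := truncn_itv v0.
by rewrite uv -natr1 ltr_norml => *; apply/andP; split; lra.
Qed.

(** One point of [A] is chosen in each nonempty cell of a square grid of mesh
    [h], on which the norm varies by at most [d]. *)
Lemma finite_net N A a0 (M d : R) : is_norm N -> A a0 -> 0 < d ->
  exists (J : finType) (G : J -> V), (forall j, A (G j)) /\
    forall x, A x -> N x <= M -> exists j, N (x - G j) <= d.
Proof.
move=> nN Aa0 d0; have [C C0 NC] := norm_coord_bound nN.
pose B := N (delta_mx 0 0) + N (delta_mx 0 1) + 1.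
have B0 : 0 < B by rewrite ltr_wpDl ?addr_ge0 ?(norm_ge0 nN).
have NB x : N x <= B * (`|x 0 0| + `|x 0 1|).
  rewrite {1}(row2E x); apply: le_trans (is_normD nN _ _) _; rewrite !(is_normZ nN).
  have := norm_ge0 nN (delta_mx 0 0 : V); have := norm_ge0 nN (delta_mx 0 1 : V).
  by have := normr_ge0 (x 0 0); have := normr_ge0 (x 0 1); rewrite /B; nra.
pose h := d / (2 * B); have h0 : 0 < h by rewrite divr_gt0 // mulr_gt0.
pose z x i := (x 0 i + C * M) / h.
have zb x i : N x <= M -> 0 <= z x i <= 2 * (C * M) / h.
  move=> xM; have : `|x 0 i| <= C * M.
    apply: le_trans (ler_wpM2l (ltW C0) xM); apply: le_trans (NC x).
    have := normr_ge0 (x 0 0); have := normr_ge0 (x 0 1).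
    case: i => -[|[|//]] i; first by rewrite (_ : Ordinal i = 0); [lra|exact: val_inj].
    by rewrite (_ : Ordinal i = 1); [lra|exact: val_inj].
  rewrite ler_norml => /andP[l u].
  by rewrite divr_ge0 ?ler_pM2r ?invr_gt0 ?(ltW h0) //=; lra.
pose K := Num.truncn (2 * (C * M) / h).
pose cell x : 'I_K.+1 * 'I_K.+1 :=
  (inord (Num.truncn (z x 0)), inord (Num.truncn (z x 1))).
have cellP x y i : N x <= M -> N y <= M -> cell x = cell y -> `|x 0 i - y 0 i| < h.
  move=> xM yM [e0 e1]; have /andP[x0 xK] := zb x i xM; have /andP[y0 yK] := zb y i yM.
  have zE : Num.truncn (z x i) = Num.truncn (z y i).
    have bnd u : N u <= M -> forall l, (Num.truncn (z u l) < K.+1)%N.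
      by move=> uM l; rewrite ltnS; apply: le_truncn; have /andP[] := zb u l uM.
    move: e0 e1 => /(congr1 val) + /(congr1 val); rewrite /= !inordK ?bnd // => e0 e1.
    case: i {x0 xK y0 yK} => -[|[|//]] i.
      by rewrite (_ : Ordinal i = 0) //; exact: val_inj.
    by rewrite (_ : Ordinal i = 1) //; exact: val_inj.
  have := truncn_near x0 y0 zE.
  rewrite /z -mulrBl opprD addrACA subrr addr0 normrM [X in _ * X]gtr0_norm ?invr_gt0 //.
  by rewrite ltr_pdivrMr // mul1r.
pose P j x := [/\ A x, N x <= M & cell x = j].
pose G j := match pselect (exists x, P j x) with
  | left e => projT1 (cid e) | right _ => a0 end.
exists _, G; split.
  by move=> j; rewrite /G; case: pselect => // e; case: cid => x [].
move=> x Ax xM; exists (cell x); rewrite /G; case: pselect => [e|[]]; last by exists x.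
case: cid => y [Ay yM yx] /=; apply: le_trans (NB _) _; rewrite !mxE.
have := cellP x y 0 xM yM (esym yx); have := cellP x y 1 xM yM (esym yx).
have dE : d = B * (h + h) by rewrite /h; field; rewrite gt_eqF.
by move=> h1 h2; rewrite dE ler_pM2l //; lra.
Qed.

(** Replacing [N] by [N + k euclid] multiplies distances by at most [1 + k C],
    where [C N] dominates the Euclidean norm. The term [1 + k] accounts for
    points that only approach the distance to [A], and the last [k] for the
    net. *)
Lemma dist_hull_le N A b (C k : R) : is_norm N -> approx_convex N A ->
  (forall x, `|x 0 0| + `|x 0 1| <= C * N x) -> 0 <= C -> 0 < k ->
  convex_hull A b -> dist N b A <= 2 * ((1 + k * C) * (1 + k) + k).
Proof.
move=> nN Acvx NC C0 k0 /caratheodory[n [a [t [Aa t0 t1 bE freea]]]].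
have [j0 _] : exists j : 'I_n, True.
  case: n a t {Aa t0 bE freea} t1 => [a t|m *]; last by exists ord0.
  by rewrite big_ord0 => /esym/eqP; rewrite oner_eq0.
pose N' x := N x + k * euclid x.
have nN' : is_norm N' := add_euclid_is_norm nN (ltW k0).
have NN' x : N x <= N' x by rewrite lerDl mulr_ge0 ?euclid_ge0 // ltW.
have N'N x : N' x <= (1 + k * C) * N x.
  rewrite /N' mulrDl mul1r lerD2l -mulrA ler_wpM2l ?(ltW k0) //.
  exact: le_trans (euclid_le x) (NC x).
pose D := \sum_j N' (a j).
have ptD s : simplex s -> N' (\sum_j s j *: a j) <= D.
  move=> [s0 s1]; apply: le_trans (norm_sum nN' _) _; apply: ler_sum => j _.
  rewrite normZ_ge0 // ler_piMl ?(norm_ge0 nN') // -s1 (bigD1 j) //= lerDl.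
  by rewrite sumr_ge0.
have aD j : N' (a j) <= D.
  by rewrite /D (bigD1 j) //= lerDl sumr_ge0 // => i _; exact: norm_ge0.
pose c0 := (1 + k * C) * (1 + k).
have [J [G [AG netG]]] := finite_net (3 * D + c0) nN' (Aa j0) k0.
pose F (i : 'I_n + J) := match i with inl j => a j | inr j => G j end.
have AF i : A (F i) by case: i.
have nearD s i : simplex s -> nearest N' F (\sum_j s j *: a j) i -> N' (F i) <= 3 * D.
  move=> ss /(_ (inl j0)) /=; have := ptD s ss; have := aD j0.
  set x := \sum_j _; have := normB_le nN' x (a j0).
  by have := le_normB nN' (F i) x; rewrite (normBC nN' (F i)); lra.
have [i bi] : exists i, N' (b - F i) <= 2 * (c0 + k).
  rewrite bE.
  apply: (@finite_bound _ N' _ F n a nN' (add_euclid_strict nN k0) freea inl) => //.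
  move=> s u i j ss su si uj; have Di := nearD _ _ ss si; have Dj := nearD _ _ su uj.
  set m := 2^-1 *: (F i + F j).
  have mD : N' m <= 3 * D.
    by rewrite normZ_ge0 ?invr_ge0 //; have := is_normD nN' (F i) (F j); lra.
  have mA : dist N m A < 1 + k.
    by apply: le_lt_trans (Acvx _ _ (AF i) (AF j)) _; rewrite ltrDl.
  have A0 : A !=set0 by exists (a j0).
  have [y Ay my] := dist_lt A0 mA.
  have my' : N' (m - y) <= c0.
    apply: le_trans (N'N _) _; rewrite /c0 ler_wpM2l ?(ltW my) //.
    by rewrite addr_ge0 // mulr_ge0 // ltW.
  have [|l yl] := netG y Ay.
    by have := le_normB nN' y m; rewrite (normBC nN' y); lra.
  exists (inr l); apply: le_trans (norm_dist_le nN' _ y _) _.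
  by rewrite lerD.
apply: le_trans (dist_le nN _ (AF i)) _; exact: le_trans (NN' _) bi.
Qed.

Theorem dist_hull_le2 N A b : is_norm N -> approx_convex N A ->
  convex_hull A b -> dist N b A <= 2.
Proof.
move=> nN Acvx Ab; have [C C0 NC] := norm_coord_bound nN.
apply/ler_addgt0Pr => e e0.
(* For [k <= 1] the error term is at most [k (4 C + 4)]. *)
pose k := Num.min 1 (e / (4 * C + 4)).
have D0 : 0 < 4 * C + 4 by lra.
have k0 : 0 < k by rewrite lt_min ltr01 divr_gt0.
apply: le_trans (dist_hull_le nN Acvx NC (ltW C0) k0 Ab) _.
have k1 : k <= 1 by rewrite ge_min lexx.
have : k * (4 * C + 4) <= e by rewrite -ler_pdivlMr // ge_min lexx orbT.
have : k * (k * C) <= 1 * (k * C) by rewrite ler_wpM2r // mulr_ge0 // ltW.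
lra.
Qed.
End upper.
(** * Sharpness *)

Section lower.
Context (R : realType) (V : lmodType R) (N : V -> R) (e f : V).
Hypotheses (nN : is_norm N) (Ne : N e = 1) (Nf : N f = 1).
Hypothesis ef : forall s : R, 1 <= N (f + s *: e).

(** The epigraph over the dyadic rationals of the function equal to
    [2 - 2 / 2^j] at the fractions with reduced denominator [2^j], stretched by
    [L] along [e]. Fractions need not be reduced: a larger [j] only asks for a
    higher point. *)
Definition dyadic_comb (L : R) : set V := [set v | exists (j : nat) (k : int) (t : R),
  2 - 2 / 2 ^+ j <= t /\ v = (k%:~R / 2 ^+ j * L) *: e + t *: f].

(** The common denominator [2^j] of two abscissas is the larger one, so their
    midpoint has level [j + 1] and the height required there is
    [2 - 1 / 2^j], at most 1 above the mean height. *)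
Lemma dyadic_comb_approx_convex L : approx_convex N (dyadic_comb L).
Proof.
have p2 j : 0 < 2 ^+ j :> R by rewrite exprn_gt0.
have wlog_le (j j' : nat) (k k' : int) (s t : R) : (j' <= j)%N ->
    2 - 2 / 2 ^+ j <= s -> 2 - 2 / 2 ^+ j' <= t ->
    dist N (2^-1 *: (((k%:~R / 2 ^+ j * L) *: e + s *: f) +
                     ((k'%:~R / 2 ^+ j' * L) *: e + t *: f))) (dyadic_comb L) <= 1.
  move=> jj js jt.
  pose k2 : int := k + k' * 2 ^+ (j - j').
  (* The set is closed upwards, so the mean height itself is used whenever it
     is allowed. *)
  pose u := Num.max ((s + t) / 2) (2 - 2 / 2 ^+ j.+1).
  pose a := (k2%:~R / 2 ^+ j.+1 * L) *: e + u *: f.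
  have Aa : dyadic_comb L a by exists j.+1, k2, u; rewrite le_max lexx orbT.
  apply: le_trans (dist_le nN _ Aa) _.
  have k2E : k2%:~R / 2 ^+ j.+1 = (k%:~R / 2 ^+ j + k'%:~R / 2 ^+ j') / 2 :> R.
    rewrite /k2 intrD intrM rmorphXn /= exprS -[in 2 ^+ j](subnK jj) exprD.
    by field; rewrite !expf_neq0.
  have -> : 2^-1 *: (((k%:~R / 2 ^+ j * L) *: e + s *: f) +
                     ((k'%:~R / 2 ^+ j' * L) *: e + t *: f)) - a =
      - (u - (s + t) / 2) *: f.
    rewrite /a k2E addrACA -(scalerDl e) -(scalerDl f) scalerDr !scalerA opprD addrACA.
    rewrite -(scalerBl _ _ e) -(scalerBl _ _ f).
    rewrite (_ : 2^-1 * (_ + _) - _ / 2 * L = 0) ?scale0r ?add0r; last first.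
      by field; rewrite !expf_neq0.
    by congr (_ *: _); field.
  rewrite (is_normZ nN) Nf mulr1 normrN ger0_norm; last by rewrite subr_ge0 le_max lexx.
  rewrite lerBlDr ge_max; apply/andP; split; first by rewrite lerDr.
  have : 2 / 2 ^+ j.+1 = (2 ^+ j)^-1 :> R by rewrite exprS; field; rewrite expf_neq0.
  have : (2 ^+ j')^-1 <= 1 :> R by rewrite invf_le1 // exprn_ege1 // ler1n.
  by move: js jt; lra.
move=> a b [j [k [s [js ->]]]] [j' [k' [t [jt ->]]]].
have [jj|/ltnW jj] := leqP j' j; first exact: wlog_le.
by rewrite addrC; exact: wlog_le.
Qed.

(** The numerator of the difference is [2^j - 3 k], nonzero since 3 does not
    divide [2^j]. *)
Lemma third_dyadic_gap (j : nat) (k : int) :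
  (3 * 2 ^+ j)^-1 <= `|3^-1 - k%:~R / 2 ^+ j| :> R.
Proof.
have p2 : 0 < 2 ^+ j :> R by rewrite exprn_gt0.
have nz : (2 ^+ j - 3 * k)%R != 0 :> int.
  rewrite subr_eq0; apply/eqP => /(congr1 absz); rewrite abszM abszX /= => h.
  have : (3 %| 2 ^ j)%N by apply/dvdnP; exists `|k|%N; rewrite mulnC -h.
  by rewrite Euclid_dvdX.
have -> : 3^-1 - k%:~R / 2 ^+ j = (2 ^+ j - 3 * k)%:~R / (3 * 2 ^+ j) :> R.
  by rewrite intrB intrM rmorphXn /=; field; rewrite expf_neq0.
rewrite normrM normfV [X in _ / X]gtr0_norm ?mulr_gt0 //.
rewrite ler_peMl ?invr_ge0 ?mulr_ge0 ?(ltW p2) //.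
by rewrite -intr_norm ler1z -gtz0_ge1 normr_gt0.
Qed.

Lemma dyadic_comb_hull L : convex_hull (dyadic_comb L) ((L / 3) *: e).
Proof.
move=> M [Mcvx AM].
have M0 : M 0.
  by apply: AM; exists 0%N, 0, 0; rewrite mul0r !mul0r !scale0r addr0 expr0 divr1 subrr.
have M1 : M (L *: e).
  by apply: AM; exists 0%N, 1, 0; rewrite expr0 !divr1 subrr mul1r scale0r addr0.
have i3 : 0 <= 3^-1 :> R by rewrite invr_ge0.
have i3' : 3^-1 <= 1 :> R by rewrite invf_le1 // ler1n.
have := Mcvx (L *: e) 0 (Itv01 i3 i3') (mem_set M1) (mem_set M0).
move/set_mem; congr M.
by rewrite /conv /= scaler0 addr0 scalerA mulrC.
Qed.

(** Points of height less than [2 - eps] have a denominator below [2 / eps], so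
    their abscissa is at least [eps / 6] away from [1/3]; the stretching factor
    turns this into a horizontal distance at least 4. With [t] the height, the
    norm is then at least both [t] and [4 - t]. *)
Lemma dyadic_comb_dist (eps : R) : 0 < eps ->
  2 - eps <= dist N ((24 / eps / 3) *: e) (dyadic_comb (24 / eps)).
Proof.
move=> eps0; apply: le_dist.
  by exists 0; exists 0%N, 0, 0; rewrite !mul0r !scale0r addr0 expr0 divr1 subrr.
move=> _ [j [k [t [jt ->]]]].
set L := 24 / eps; have L0 : 0 < L by rewrite divr_gt0.
have p2 : 0 < 2 ^+ j :> R by rewrite exprn_gt0.
pose x : R := 3^-1 - k%:~R / 2 ^+ j.
rewrite (_ : _ - _ = (x * L) *: e - t *: f); last first.
  by rewrite opprD addrA -scalerBl; congr (_ *: _ - _); rewrite /x; ring.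
have tN : t <= N ((x * L) *: e - t *: f).
  apply: le_trans (ler_norm t) _; rewrite normBC // -scaleNr -[X in X <= _]mulr1 -Nf.
  by apply: orthogonal_norm_ge => // s; rewrite Nf.
have [jl|jl] := leP (2 / 2 ^+ j) eps; first lra.
have xN : `|x| * L - `|t| <= N ((x * L) *: e - t *: f).
  have := le_normB nN ((x * L) *: e) (t *: f).
  by rewrite !(is_normZ nN) Ne Nf !mulr1 normrM (gtr0_norm L0).
have t0 : 0 <= t.
  by apply: le_trans jt; rewrite subr_ge0 ler_pdivrMr //;
    rewrite ler_peMr // exprn_ege1 // ler1n.
rewrite (ger0_norm t0) in xN.
have : 4 <= `|x| * L.
  apply: le_trans (_ : (3 * 2 ^+ j)^-1 * L <= _); last first.
    by rewrite ler_wpM2r ?(ltW L0) // third_dyadic_gap.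
  move: jl; rewrite ltr_pdivlMr // => jl.
  rewrite mulrC ler_pdivlMr ?mulr_gt0 // /L ler_pdivlMr //; nra.
lra.
Qed.
End lower.

Lemma sharp_example (R : realType) (N : 'rV[R]_2 -> R) (eps : R) : is_norm N -> 0 < eps ->
  exists (A : set 'rV[R]_2) (b : 'rV[R]_2),
    [/\ approx_convex N A, convex_hull A b & 2 - eps <= dist N b A].
Proof.
move=> nN eps0.
pose e0 : 'rV[R]_2 := delta_mx 0 0; pose g : 'rV[R]_2 := delta_mx 0 1.
have e0n : e0 != 0.
  by apply/eqP => /matrixP /(_ 0 0)/eqP; rewrite !mxE /= oner_eq0.
have [s0 hs] := birkhoff_orthogonal g nN e0n.
set f0 := g + s0 *: e0 in hs.
have f0n : f0 != 0.
  by apply/eqP => /matrixP /(_ 0 1)/eqP; rewrite !mxE /= mulr0 addr0 oner_eq0.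
have Ne := norm_gt0 nN e0n; have Nf := norm_gt0 nN f0n.
pose e := (N e0)^-1 *: e0; pose f := (N f0)^-1 *: f0.
have Ne1 : N e = 1 by rewrite normZ_ge0 ?invr_ge0 ?(ltW Ne) // mulVf ?gt_eqF.
have Nf1 : N f = 1 by rewrite normZ_ge0 ?invr_ge0 ?(ltW Nf) // mulVf ?gt_eqF.
have ef s : 1 <= N (f + s *: e).
  have hf u : N f0 <= N (f0 + u *: e0) by rewrite -addrA -scalerDl.
  have := orthogonal_norm_ge nN hf (s / N e0) (N f0)^-1.
  by rewrite gtr0_norm ?invr_gt0 // mulVf ?gt_eqF // scalerA.
exists (dyadic_comb e f (24 / eps)), ((24 / eps / 3) *: e); split.
- exact: dyadic_comb_approx_convex.
- exact: dyadic_comb_hull.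
- exact: dyadic_comb_dist.
Qed.

Theorem theorem3p14 (R : realType) :
  (forall (N : 'rV[R]_2 -> R) (A : set 'rV[R]_2),
     is_norm N -> A !=set0 -> approx_convex N A ->
     forall b : 'rV[R]_2, convex_hull A b -> dist N b A <= 2) /\
  (forall N : 'rV[R]_2 -> R, is_norm N ->
     forall eps : R, 0 < eps ->
     exists (A : set 'rV[R]_2) (b : 'rV[R]_2),
       [/\ approx_convex N A, convex_hull A b & 2 - eps <= dist N b A]).
Proof.
split=> [N A nN _ Acvx b Ab|N nN eps eps0]; first exact: dist_hull_le2.
exact: sharp_example.
Qed.
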